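(* Let $m\le n$ be positive integers, let $f:\mathbb{R}^n\to\mathbb{R}$ be differentiable, $T\in\mathbb{R}^{m\times n}$, $b\in\mathbb{R}^m$, and $\alpha>0$. Consider the problem $$\min_{x\in\mathbb{R}^n} f(x)\quad\text{subject to } Tx=b. \qquad (P)$$ Assume: 1. (Convexity) $(\nabla f(x)-\nabla f(\hat x))^\top(x-\hat x)\ge 0$ for all $x,\hat x\in\mathbb{R}^n$. 2. (Lipschitz smoothness) There is $l>0$ such that $(\nabla f(x)-\nabla f(\hat x))^\top(x-\hat x)\le l\|x-\hat x\|^2$ for all $x,\hat x\in\mathbb{R}^n$. 3. $T$ has full row rank and $\kappa_1 I_m\preceq TT^\top\preceq\kappa_2 I_m$ for some $\kappa_2\ge\kappa_1>0$. 4. (Partial strong convexity) If $m<n$: let $T^\top=QR$ be a QR decomposition with $Q\in\mathbb{R}^{n\times n}$ orthogonal and $R=\begin{bmatrix}R_1\\ \mathbf{0}\end{bmatrix}$, $R_1\in\mathbb{R}^{m\times m}$ upper triangular. Then the function $g(x'):=f(Qx')$ is $\mu$-partially strongly convex, for some $\mu>0$, with respect to the partitioned vector $x'_S$ with $S=\{m+1,\ldots,n\}$. 5. Problem (P) has a finite and feasible optimal solution. Then the variable $x(t)$ of the augmented primal-dual gradient algorithm $$\dot x=-\nabla f(x)-T^\top\lambda-\alpha T^\top(Tx-b),\qquad \dot\lambda=Tx-b$$ (with $x(t)\in\mathbb{R}^n$, $\lambda(t)\in\mathbb{R}^m$) exponentially converges to the optimal solution $x^*$ of (P).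
   Context: $\|\cdot\|$ is the Euclidean norm. For symmetric matrices, $A\preceq B$ means that $B-A$ is positive semidefinite. For $S\subset\{1,\ldots,n\}$ and $x\in\mathbb{R}^n$, the partitioned vector $x_S$ is the restriction of $x$ to the coordinates with index in $S$. A differentiable function $g:\mathbb{R}^n\to\mathbb{R}$ is $\mu$-partially strongly convex with respect to the partitioned vector $x_S$ if $(\nabla g(x)-\nabla g(\hat x))^\top(x-\hat x)\ge\mu\|x_S-\hat x_S\|^2$ for all $x,\hat x\in\mathbb{R}^n$. ''$x(t)$ exponentially converges to the optimal solution $x^*$'' means: there are $\lambda^*$ such that $(x^*,\lambda^* )$ is an equilibrium of the dynamics, and constants $c\ge 0$, $\rho>0$, independent of the initial condition, such that for every initial condition $(x(0),\lambda(0))$ and all $t\ge 0$, $\|x(t)-x^*\|\le c\,e^{-\rho t}\,\|(x(0),\lambda(0))-(x^*,\lambda^* )\|$. *)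

(* Defs.v *)
From HB Require Import structures.
From mathcomp Require Import all_boot all_order all_algebra.
From mathcomp Require Import all_classical all_reals all_analysis.
Set Implicit Arguments.
Unset Strict Implicit.
Unset Printing Implicit Defensive.
Import Order.TTheory GRing.Theory Num.Theory.
Import numFieldNormedType.Exports.
Local Open Scope classical_set_scope.
Local Open Scope ring_scope.

Section defs.
Context {R : realType}.

Definition dotv {n : nat} (u v : 'cV[R]_n) : R := (u^T *m v) 0 0.

(* The library norm `|v| on matrices is the sup norm, hence a separate
   Euclidean norm; both induce the same topology, so [differentiable],
   [continuous] and [is_derive] have their usual meaning on 'cV[R]_n. *)
Definition enorm {n : nat} (v : 'cV[R]_n) : R := Num.sqrt (dotv v v).

Definition grad {n : nat} (f : 'cV[R]_n -> R) (x : 'cV[R]_n) : 'cV[R]_n :=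
  \col_i 'D_(delta_mx i 0) f x.

Definition psdmx {n : nat} (A : 'M[R]_n) : Prop :=
  A^T = A /\ forall v : 'cV[R]_n, 0 <= dotv v (A *m v).

Definition loewner_le {n : nat} (A B : 'M[R]_n) : Prop := psdmx (B - A).

(* The coordinates of x with index in S, listed in increasing order. *)
Definition subvec {n : nat} (S : {set 'I_n}) (x : 'cV[R]_n) : 'cV[R]_#|S| :=
  \col_(k < #|S|) x (enum_val k) 0.

Definition partially_strongly_convex {n : nat} (mu : R) (S : {set 'I_n})
    (g : 'cV[R]_n -> R) : Prop :=
  forall x xh : 'cV[R]_n,
    dotv (grad g x - grad g xh) (x - xh)
      >= mu * enorm (subvec S x - subvec S xh) ^+ 2.

(* A = Q R with Q orthogonal and R = [R1; 0], where R1, the block of the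
   first m rows of R, is upper triangular ([is_trig_mx] means lower
   triangular, whence the transpose). *)
Definition is_QR {m n : nat} (hmn : (m <= n)%N) (A : 'M[R]_(n, m))
    (Q : 'M[R]_n) (Rf : 'M[R]_(n, m)) : Prop :=
  [/\ A = Q *m Rf,
      Q *m Q^T = 1%:M /\ Q^T *m Q = 1%:M,
      is_trig_mx (rowsub (widen_ord hmn) Rf)^T
    & forall (i : 'I_n) (j : 'I_m), (m <= i)%N -> Rf i j = 0].

Definition is_optimal {m n : nat} (f : 'cV[R]_n -> R) (T : 'M[R]_(m, n))
    (b : 'cV[R]_m) (xs : 'cV[R]_n) : Prop :=
  T *m xs = b /\ forall x : 'cV[R]_n, T *m x = b -> f xs <= f x.

Definition apdg_x {m n : nat} (f : 'cV[R]_n -> R) (T : 'M[R]_(m, n))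
    (b : 'cV[R]_m) (alpha : R) (x : 'cV[R]_n) (lam : 'cV[R]_m) : 'cV[R]_n :=
  - grad f x - T^T *m lam - alpha *: (T^T *m (T *m x - b)).

Definition apdg_lam {m n : nat} (T : 'M[R]_(m, n)) (b : 'cV[R]_m)
    (x : 'cV[R]_n) : 'cV[R]_m :=
  T *m x - b.

Definition is_equilibrium {m n : nat} (f : 'cV[R]_n -> R) (T : 'M[R]_(m, n))
    (b : 'cV[R]_m) (alpha : R) (x : 'cV[R]_n) (lam : 'cV[R]_m) : Prop :=
  apdg_x f T b alpha x lam = 0 /\ apdg_lam T b x = 0.

(* Trajectories on [0, +oo[: continuous up to t = 0, and satisfying the
   differential equation for t > 0. Values at t < 0 are irrelevant, so no
   two-sided derivative is asked for at t = 0. *)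
Definition is_trajectory {m n : nat} (f : 'cV[R]_n -> R) (T : 'M[R]_(m, n))
    (b : 'cV[R]_m) (alpha : R) (x : R -> 'cV[R]_n) (lam : R -> 'cV[R]_m)
    : Prop :=
  [/\ {within `[0, +oo[, continuous x},
      {within `[0, +oo[, continuous lam}
    & forall t : R, 0 < t ->
        is_derive t (1 : R) x (apdg_x f T b alpha (x t) (lam t)) /\
        is_derive t (1 : R) lam (apdg_lam T b (x t))].

Definition exponentially_converges {m n : nat} (f : 'cV[R]_n -> R)
    (T : 'M[R]_(m, n)) (b : 'cV[R]_m) (alpha : R) (xs : 'cV[R]_n) : Prop :=
  exists ls : 'cV[R]_m, is_equilibrium f T b alpha xs ls /\
  exists c rho : R, [/\ 0 <= c, 0 < rho
    & forall (x : R -> 'cV[R]_n) (lam : R -> 'cV[R]_m),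
        is_trajectory f T b alpha x lam ->
        forall t : R, 0 <= t ->
          enorm (x t - xs)
            <= c * expR (- rho * t) * enorm (col_mx (x 0 - xs) (lam 0 - ls))].

End defs.

(* Main.v *)
Require Import Defs.
From HB Require Import structures.
From mathcomp Require Import all_boot all_order all_algebra.
From mathcomp Require Import all_classical all_reals all_analysis.
From mathcomp Require Import ring lra.
Set Implicit Arguments.
Unset Strict Implicit.
Unset Printing Implicit Defensive.
Import Order.TTheory GRing.Theory Num.Theory.
Import numFieldNormedType.Exports.
Local Open Scope classical_set_scope.
Local Open Scope ring_scope.

(** Write e = x - x*, nu = lambda - lambda* and h = grad f x - grad f x*, where
    lambda* is a multiplier of the optimal point x*: optimality makes grad f x*
    orthogonal to ker T, hence an element of the range of T^T
    ([multiplier_exists]).  Relative to this equilibrium the flow reads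
      e' = - h - T^T nu - alpha T^T T e,    nu' = T e,
    so (|e|^2 + |nu|^2) / 2 decreases at the rate h.e + alpha |T e|^2.

    That rate controls |e|^2.  Partial strong convexity bounds the coordinates
    of Q^T e with index at least m, which are the component of e in ker T, by
    h.e; the remaining ones are seen by T, because T e is the image of them
    under R1^T, where the triangular factor R1 of T^T is invertible
    ([partial_to_constraint_coercivity]).

    The rate contains no term in nu.  Adding eps nu.(T e) to the energy supplies
    one: the derivative of nu.(T e) contains - |T^T nu|^2, which is at most
    - kappa1 |nu|^2.  The error terms are |T e|^2, |T^T T e|^2 and |h|^2.  The
    first two are bounded by multiples of |T e|^2 and the last one by a multiple
    of h.e, because the gradient of a smooth convex function is cocoercive
    ([gradient_cocoercive]); a small eps lets the decrease of the energy absorb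
    them.  The resulting function V ([lyapunov]) is comparable to
    |e|^2 + |nu|^2 ([lyapunov_equiv]) and satisfies V' <= - rho V
    ([lyapunov_dissipation]), so it decays exponentially
    ([exponential_decay]), and with it |e|^2 <= 4 V. *)

(** * Euclidean inner product *)

Section EuclideanProduct.
Context {R : realType}.

Lemma dotv_sum n (u v : 'cV[R]_n) : dotv u v = \sum_i u i 0 * v i 0.
Proof. by rewrite /dotv mxE; apply: eq_bigr => i _; rewrite mxE. Qed.

Lemma dotvC n (u v : 'cV[R]_n) : dotv u v = dotv v u.
Proof. by rewrite !dotv_sum; apply: eq_bigr => i _; rewrite mulrC. Qed.

Lemma dotvDr n (u v w : 'cV[R]_n) : dotv u (v + w) = dotv u v + dotv u w.
Proof. by rewrite /dotv mulmxDr mxE. Qed.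

Lemma dotvNr n (u v : 'cV[R]_n) : dotv u (- v) = - dotv u v.
Proof. by rewrite /dotv mulmxN mxE. Qed.

Lemma dotvZr n a (u v : 'cV[R]_n) : dotv u (a *: v) = a * dotv u v.
Proof. by rewrite /dotv -scalemxAr mxE. Qed.

Lemma dotvDl n (u v w : 'cV[R]_n) : dotv (u + v) w = dotv u w + dotv v w.
Proof. by rewrite dotvC dotvDr !(dotvC w). Qed.

Lemma dotvNl n (u v : 'cV[R]_n) : dotv (- u) v = - dotv u v.
Proof. by rewrite dotvC dotvNr dotvC. Qed.

Lemma dotvZl n a (u v : 'cV[R]_n) : dotv (a *: u) v = a * dotv u v.
Proof. by rewrite dotvC dotvZr dotvC. Qed.

Definition dotv_linear := (dotvDl, dotvDr, dotvNl, dotvNr, dotvZl, dotvZr).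

Lemma dotv_mulmx m n (A : 'M[R]_(m, n)) u v :
  dotv u (A *m v) = dotv (A^T *m u) v.
Proof. by rewrite /dotv trmx_mul trmxK mulmxA. Qed.

Lemma dotv_ge0 n (u : 'cV[R]_n) : 0 <= dotv u u.
Proof. by rewrite dotv_sum sumr_ge0// => i _; rewrite -expr2 sqr_ge0. Qed.

Lemma dotv_eq0 n (u : 'cV[R]_n) : dotv u u <= 0 -> u = 0.
Proof.
move=> u0; have /eqP : dotv u u = 0 by apply/le_anti; rewrite u0 dotv_ge0.
rewrite dotv_sum psumr_eq0; last by move=> i _; rewrite -expr2 sqr_ge0.
move=> /allP ui0; apply/matrixP => i j; rewrite ord1 mxE.
by have := ui0 i (mem_index_enum _); rewrite /= mulf_eq0 orbb => /eqP.
Qed.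

Lemma enorm_sqr n (u : 'cV[R]_n) : enorm u ^+ 2 = dotv u u.
Proof. by rewrite sqr_sqrtr// dotv_ge0. Qed.

Lemma dotv_col_mx m n (u : 'cV[R]_m) (v : 'cV[R]_n) :
  dotv (col_mx u v) (col_mx u v) = dotv u u + dotv v v.
Proof. by rewrite {1}/dotv tr_col_mx mul_row_col mxE. Qed.

(** The weighted form is what lets a cross term be absorbed with an arbitrarily
    small share of one of the two squares. *)
Lemma dotv_young n (a : R) (u v : 'cV[R]_n) : 0 < a ->
  dotv u v <= a * dotv u u + dotv v v / (4 * a).
Proof.
move=> a0; have := dotv_ge0 ((2 * a) *: u - v).
rewrite !dotv_linear (dotvC v u) => H.
rewrite -subr_ge0; set d := (X in 0 <= X).
have -> : d = (2 * a * (2 * a * dotv u u) - 2 * a * dotv u v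
    - (2 * a * dotv u v - dotv v v)) / (4 * a) by rewrite /d; field; lra.
by apply: divr_ge0; lra.
Qed.

Lemma scalar_le_gram m n (T : 'M[R]_(m, n)) k (w : 'cV[R]_m) :
  loewner_le k%:M (T *m T^T) -> k * dotv w w <= dotv (T^T *m w) (T^T *m w).
Proof.
move=> [_ /(_ w)]; rewrite mulmxBl mul_scalar_mx !dotv_linear -mulmxA.
by rewrite -dotv_mulmx subr_ge0.
Qed.

Lemma gram_le_scalar m n (T : 'M[R]_(m, n)) k (w : 'cV[R]_m) :
  loewner_le (T *m T^T) k%:M -> dotv (T^T *m w) (T^T *m w) <= k * dotv w w.
Proof.
move=> [_ /(_ w)]; rewrite mulmxBl mul_scalar_mx !dotv_linear -mulmxA.
by rewrite -dotv_mulmx subr_ge0.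
Qed.

Lemma gram_unitmx m n (T : 'M[R]_(m, n)) k : 0 < k ->
  loewner_le k%:M (T *m T^T) -> T *m T^T \in unitmx.
Proof.
move=> k0 kT; rewrite -row_free_unit; apply: inj_row_free => v vTT0.
have Tv0 : T^T *m v^T = 0.
  apply: dotv_eq0; rewrite -dotv_mulmx mulmxA.
  have /(congr1 trmx) := vTT0; rewrite !trmx_mul trmxK trmx0 => ->.
  by rewrite /dotv mulmx0 mxE.
have := scalar_le_gram v^T kT; rewrite Tv0 {2}/dotv mulmx0 mxE pmulr_rle0//.
by move=> /dotv_eq0 /(congr1 trmx); rewrite trmxK trmx0.
Qed.

End EuclideanProduct.

(** * Gradients of smooth convex functions *)

Section Gradient.
Context {R : realType}.

Lemma derive_grad n (f : 'cV[R]_n -> R) x v : differentiable f x ->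
  'D_v f x = dotv (grad f x) v.
Proof.
move=> df; rewrite deriveE//.
have -> : v = \sum_i v i 0 *: delta_mx i 0.
  rewrite {1}(matrix_sum_delta v); apply: eq_bigr => i _.
  by rewrite big_ord_recl big_ord0 addr0.
rewrite linear_sum dotv_sum; apply: eq_bigr => i _.
rewrite linearZ /= !mxE deriveE// mulrC; congr *%R.
rewrite summxE (bigD1 i)//= big1 ?addr0.
  by rewrite !mxE !eqxx mulr1.
by move=> j ji; rewrite !mxE eq_sym (negbTE ji) mulr0.
Qed.

(** The difference quotients of the two sides coincide. *)
Lemma derive_comp_mulmx n p (f : 'cV[R]_n -> R) (Q : 'M[R]_(n, p))
    (x v : 'cV[R]_p) :
  'D_v (fun y => f (Q *m y)) x = 'D_(Q *m v) f (Q *m x).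
Proof.
suff E : (fun h => h^-1 *: (((fun y => f (Q *m y)) \o shift x) (h *: v)
             - f (Q *m x))) =
         (fun h => h^-1 *: ((f \o shift (Q *m x)) (h *: (Q *m v))
             - f (Q *m x))).
  by rewrite /derive E.
by apply/funext => h /=; rewrite mulmxDr scalemxAr.
Qed.

Lemma grad_comp_mulmx n p (f : 'cV[R]_n -> R) (Q : 'M[R]_(n, p)) x :
  differentiable f (Q *m x) ->
  grad (fun y => f (Q *m y)) x = Q^T *m grad f (Q *m x).
Proof.
move=> df; apply/matrixP => i j; rewrite ord1 mxE derive_comp_mulmx.
rewrite derive_grad// dotv_mulmx dotv_sum (bigD1 i)//= big1 ?addr0.
  by rewrite [delta_mx _ _ _ _]mxE !eqxx mulr1.
by move=> k ki; rewrite [delta_mx _ _ _ _]mxE (negbTE ki) mulr0.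
Qed.

Lemma is_derive_line n (f : 'cV[R]_n -> R) x d (t : R) :
  differentiable f (x + t *: d) ->
  is_derive t (1 : R) (fun s => f (x + s *: d)) (dotv (grad f (x + t *: d)) d).
Proof.
move=> df; rewrite -derive_grad//.
have E : (fun h => h^-1 *: (((fun s : R => f (x + s *: d)) \o shift t)
                                (h *: (1 : R)) - f (x + t *: d))) =
         (fun h => h^-1 *: ((f \o shift (x + t *: d)) (h *: d)
                                - f (x + t *: d))).
  apply/funext => h /=; congr (_ *: (f _ - _)).
  by rewrite [_%:A]mulr1 scalerDl addrCA.
split; last by rewrite /derive E.
by rewrite /derivable E; exact: diff_derivable.
Qed.

Lemma mean_value n (f : 'cV[R]_n -> R) x d : (forall y, differentiable f y) ->
  exists2 c, 0 < c < 1 & f (x + d) - f x = dotv (grad f (x + c *: d)) d.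
Proof.
move=> df; have dline t := is_derive_line (df (x + t *: d)).
have cline : {within `[(0 : R), 1], continuous (fun s : R => f (x + s *: d))}.
  apply: continuous_subspaceT => t.
  exact/differentiable_continuous/derivable1_diffP.
have [c] := MVT (@ltr01 R) (fun t _ => dline t) cline.
rewrite in_itv /= scale1r scale0r addr0 subr0 mulr1 => c01 fE.
by exists c.
Qed.


Lemma convex_tangent n (f : 'cV[R]_n -> R) : (forall x, differentiable f x) ->
  (forall x y, 0 <= dotv (grad f x - grad f y) (x - y)) ->
  forall x y, dotv (grad f x) (y - x) <= f y - f x.
Proof.
move=> df cvxf x y; have [c /andP[c0 _]] := mean_value x (y - x) df.
rewrite subrKC => ->; rewrite -subr_ge0 -dotvNl -dotvDl.
have := cvxf (x + c *: (y - x)) x.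
by rewrite addrAC subrr add0r dotvZr pmulr_rge0.
Qed.

(** The mean value theorem compares the gradients at x and at a point of the
    segment from x to y, a distance at most |y - x| apart; this yields the
    coefficient l instead of the sharp l / 2, which would need integration along
    the segment. *)
Lemma smooth_upper_bound n (f : 'cV[R]_n -> R) l :
  (forall x, differentiable f x) -> 0 < l ->
  (forall x y, dotv (grad f x - grad f y) (x - y) <= l * enorm (x - y) ^+ 2) ->
  forall x y, f y - f x <= dotv (grad f x) (y - x) + l * dotv (y - x) (y - x).
Proof.
move=> df l0 smf x y; have [c /andP[c0 c1]] := mean_value x (y - x) df.
rewrite subrKC => ->; rewrite -lerBlDl -dotvNl -dotvDl.
have := smf (x + c *: (y - x)) x.
rewrite enorm_sqr addrAC subrr add0r !dotvZr !dotvZl mulrCA ler_pM2l//.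
move=> /le_trans; apply; rewrite ler_pM2l//.
by rewrite ler_piMl ?dotv_ge0// ltW.
Qed.

(** The Baillon-Haddad argument: f lies above its tangent at u and below its
    quadratic upper bound at v; comparing the two at a gradient step from v
    leaves a multiple of |grad f v - grad f u|^2, and adding the result to
    itself with u and v exchanged removes the values of f.  The factor 2
    reflects the coefficient in [smooth_upper_bound]. *)
Lemma gradient_cocoercive n (f : 'cV[R]_n -> R) l :
  (forall x, differentiable f x) -> 0 < l ->
  (forall x y, 0 <= dotv (grad f x - grad f y) (x - y)) ->
  (forall x y, dotv (grad f x - grad f y) (x - y) <= l * enorm (x - y) ^+ 2) ->
  forall x y, dotv (grad f x - grad f y) (grad f x - grad f y)
              <= 2 * l * dotv (grad f x - grad f y) (x - y).
Proof.
move=> df l0 cvxf smf x y.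
have half u v : dotv (grad f v - grad f u) (grad f v - grad f u) / (4 * l)
    <= f v - f u - dotv (grad f u) (v - u).
  have [k vk] : exists k, grad f v = grad f u + k.
    by exists (grad f v - grad f u); rewrite subrKC.
  have -> : grad f v - grad f u = k by rewrite vk addrAC subrr add0r.
  (* The minimizer of the quadratic upper bound minus the tangent. *)
  pose z := v - (2 * l)^-1 *: k.
  have low := convex_tangent df cvxf u z.
  have up := smooth_upper_bound df l0 smf v z.
  have zu : z - u = (v - u) - (2 * l)^-1 *: k by rewrite /z addrAC.
  have zv : z - v = - ((2 * l)^-1 *: k) by rewrite /z addrAC subrr add0r.
  move: low up; rewrite zu zv vk !dotv_linear.
  move=> low up; have ln0 : l != 0 by rewrite gt_eqF.
  have E : dotv k k / (4 * l) = (2 * l)^-1 * dotv k k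
       - l * (- ((2 * l)^-1 * - ((2 * l)^-1 * dotv k k))) by field.
  by rewrite E; lra.
have Hxy := half x y; have Hyx := half y x.
rewrite -(ler_pM2r (_ : 0 < (2 * l)^-1)) ?invr_gt0 ?mulr_gt0//.
have -> : 2 * l * dotv (grad f x - grad f y) (x - y) / (2 * l) =
    dotv (grad f x - grad f y) (x - y) by field; rewrite gt_eqF.
have ln0 : l != 0 by rewrite gt_eqF.
have E : dotv (grad f x - grad f y) (grad f x - grad f y) / (2 * l) =
  dotv (grad f x - grad f y) (grad f x - grad f y) / (4 * l)
  + dotv (grad f y - grad f x) (grad f y - grad f x) / (4 * l).
  by rewrite -(opprB (grad f x)) !dotv_linear; field.
rewrite E; apply: le_trans (lerD Hyx Hxy) _.
rewrite le_eqVlt; apply/orP; left; apply/eqP; rewrite !dotv_linear; ring.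
Qed.

Lemma grad_at_min_along n (f : 'cV[R]_n -> R) x d :
  (forall y, differentiable f y) -> (forall t : R, f x <= f (x + t *: d)) ->
  dotv (grad f x) d = 0.
Proof.
move=> df fmin; have dline t := is_derive_line (df (x + t *: d)).
have [||||_ ] := @derive1_at_min R (fun s => f (x + s *: d)) (-1) 1 0.
- lra.
- by move=> t _; have [] := dline t.
- by rewrite in_itv/=; apply/andP; split; lra.
- by move=> t _; rewrite scale0r addr0.
have -> := @derive_val _ _ _ _ _ _ _ (dline 0).
by rewrite scale0r addr0.
Qed.

(** The residual d of projecting grad f xs orthogonally onto the range of T^T
    lies in ker T, a space of feasible directions, so grad f xs is orthogonal to
    d; hence so is d itself, and d = 0. *)
Lemma multiplier_exists m n (f : 'cV[R]_n -> R) (T : 'M[R]_(m, n)) b xs :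
  (forall x, differentiable f x) -> T *m T^T \in unitmx ->
  is_optimal f T b xs -> exists ls, grad f xs + T^T *m ls = 0.
Proof.
move=> df TTu [Txs fmin].
exists (- (invmx (T *m T^T) *m (T *m grad f xs))).
set w := invmx _ *m _; set d := _ + _.
have Td : T *m d = 0.
  by rewrite /d mulmxDr !mulmxN mulmxA /w mulKVmx ?subrr// mulmxA.
apply: dotv_eq0; rewrite {1}/d dotvDl mulmxN dotvNl -dotv_mulmx.
rewrite Td {2}/dotv mulmx0 mxE subr0.
rewrite grad_at_min_along// => t; apply: fmin.
by rewrite mulmxDr -scalemxAr Td scaler0 addr0.
Qed.

End Gradient.

(** * Coercivity from convexity transverse to the constraint *)

Section Coercivity.
Context {R : realType}.

Lemma dotv_split m n (hmn : (m <= n)%N) (x : 'cV[R]_n) :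
  dotv x x = dotv (rowsub (widen_ord hmn) x) (rowsub (widen_ord hmn) x)
    + dotv (subvec [set i : 'I_n | (m <= i)%N]%SET x)
           (subvec [set i : 'I_n | (m <= i)%N]%SET x).
Proof.
rewrite !dotv_sum (bigID (fun i : 'I_n => (i < m)%N)) /=; congr (_ + _).
  rewrite (big_ord_narrow hmn); apply: eq_bigr => i _.
  by rewrite !mxE.
under [RHS]eq_bigr do rewrite mxE.
rewrite -(big_enum_val (fun i : 'I_n => x i 0 * x i 0)).
by apply: eq_bigl => i; rewrite inE -leqNgt.
Qed.

Lemma subvecB n (S : {set 'I_n}) (x y : 'cV[R]_n) :
  subvec S x - subvec S y = subvec S (x - y).
Proof. by apply/matrixP => i j; rewrite !mxE. Qed.

(** Let R1 be the block of the first m rows of Rf and y the first m coordinates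
    of Q^T x, so that T x = R1^T y and T T^T = R1^T R1.  The latter makes R1
    invertible; for y = R1 u, |y|^2 = u.(T x) while k |u|^2 <= |y|^2, and
    Young's inequality eliminates u. *)
Lemma leading_coordinates_bound m n (hmn : (m <= n)%N) (T : 'M[R]_(m, n))
    (Q : 'M[R]_n) (Rf : 'M[R]_(n, m)) k (x : 'cV[R]_n) : 0 < k ->
  loewner_le k%:M (T *m T^T) ->
  T^T = Q *m Rf -> Q^T *m Q = 1%:M ->
  (forall (i : 'I_n) (j : 'I_m), (m <= i)%N -> Rf i j = 0) ->
  dotv (rowsub (widen_ord hmn) (Q^T *m x)) (rowsub (widen_ord hmn) (Q^T *m x))
    <= dotv (T *m x) (T *m x) / k.
Proof.
move=> k0 kT TQR QQ Rf0; set y := rowsub _ _.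
set R1 := rowsub (widen_ord hmn) Rf.
have narrow p (A : 'M[R]_(n, p)) : Rf^T *m A = R1^T *m rowsub (widen_ord hmn) A.
  apply/matrixP => i j; rewrite !mxE (bigID (fun i : 'I_n => (i < m)%N)) /=.
  rewrite [X in _ + X]big1 ?addr0; last first.
    by move=> l; rewrite -leqNgt => ml; rewrite mxE Rf0// mul0r.
  by rewrite (big_ord_narrow hmn); apply: eq_bigr => l _; rewrite !mxE.
have TE : T = Rf^T *m Q^T by rewrite -trmx_mul -TQR trmxK.
have Tx : T *m x = R1^T *m y by rewrite TE -mulmxA narrow.
have gramE : T *m T^T = R1^T *m R1.
  by rewrite {1}TE TQR -mulmxA (mulmxA Q^T) QQ mul1mx narrow.
have := gram_unitmx k0 kT; rewrite gramE unitmx_mul => /andP[_ R1u].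
have [u yE] : exists u, y = R1 *m u.
  by exists (invmx R1 *m y); rewrite mulKVmx.
have yTu : dotv y y = dotv u (T *m x).
  by rewrite Tx {1}yE dotv_mulmx trmxK.
have ku : k * dotv u u <= dotv y y.
  apply: le_trans (scalar_le_gram u kT) _.
  by rewrite -dotv_mulmx mulmxA gramE -mulmxA dotv_mulmx trmxK -yE.
have := dotv_young u (T *m x) (_ : 0 < k / 2); rewrite divr_gt0// => /(_ isT).
rewrite -yTu => young.
have E : dotv (T *m x) (T *m x) / (4 * (k / 2)) =
    (dotv (T *m x) (T *m x) / k) / 2.
  by field; rewrite gt_eqF.
by move: young; rewrite E; lra.
Qed.

(** Once |T e|^2 is available, partial strong convexity in the coordinates
    orthogonal to the range of T^T amounts to full strong convexity. *)
Lemma partial_to_constraint_coercivity m n (hmn : (m <= n)%N)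
    (f : 'cV[R]_n -> R) (T : 'M[R]_(m, n)) k :
  (forall x, differentiable f x) ->
  (forall x y, 0 <= dotv (grad f x - grad f y) (x - y)) ->
  0 < k -> loewner_le k%:M (T *m T^T) ->
  ((m < n)%N -> exists (Q : 'M[R]_n) (Rf : 'M[R]_(n, m)),
       is_QR hmn T^T Q Rf /\
       exists mu : R, 0 < mu /\
         partially_strongly_convex mu [set i : 'I_n | (m <= i)%N]%SET
           (fun x' : 'cV[R]_n => f (Q *m x'))) ->
  exists2 mu, 0 < mu & forall x y,
    dotv (x - y) (x - y) <= dotv (grad f x - grad f y) (x - y) / mu
      + dotv (T *m (x - y)) (T *m (x - y)) / k.
Proof.
move=> df cvxf k0 kT hpsc.
have [Q [Rf [[TQR QQt QtQ Rf0] [mu [mu0 psc]]]]] :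
  exists (Q : 'M[R]_n) (Rf : 'M[R]_(n, m)),
    [/\ T^T = Q *m Rf, Q *m Q^T = 1%:M, Q^T *m Q = 1%:M &
       forall (i : 'I_n) (j : 'I_m), (m <= i)%N -> Rf i j = 0] /\
    exists mu : R, 0 < mu /\
         partially_strongly_convex mu [set i : 'I_n | (m <= i)%N]%SET
           (fun x' : 'cV[R]_n => f (Q *m x')).
  have [/hpsc [Q [Rf [[? [? ?] _ ?] psc]]]|nm] := ltnP m n.
    by exists Q, Rf; split.
  (* For m = n no coordinate has index at least m: any orthogonal Q will do,
     and plain convexity is all that is required of f. *)
  exists 1%:M, T^T; split.
    rewrite !mul1mx trmx1 mul1mx; split=> // i j.
    by rewrite leqNgt (leq_trans (ltn_ord i) nm).
  exists 1; split=> // x y; rewrite !grad_comp_mulmx// trmx1 !mul1mx.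
  rewrite mul1r enorm_sqr subvecB.
  apply: le_trans (cvxf x y).
  rewrite dotv_sum big1// => i _; exfalso.
  have := enum_valP i; rewrite inE leqNgt (leq_trans (ltn_ord _) nm)//.
exists mu => // x y.
have -> : dotv (x - y) (x - y) = dotv (Q^T *m (x - y)) (Q^T *m (x - y)).
  by rewrite -dotv_mulmx mulmxA QQt mul1mx.
rewrite (dotv_split hmn) addrC lerD//; last first.
  exact: (leading_coordinates_bound hmn _ k0 kT TQR QtQ Rf0).
have := psc (Q^T *m x) (Q^T *m y).
rewrite !grad_comp_mulmx// !mulmxA QQt !mul1mx -!mulmxBr.
rewrite -dotv_mulmx mulmxA QQt mul1mx enorm_sqr subvecB -mulmxBr => H.
by rewrite ler_pdivlMr// mulrC.
Qed.

End Coercivity.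

(** * Bilinear forms along curves and exponential decay *)

Section Curves.
Context {R : realType}.

Lemma dotv_mulmx_sum m n (A : 'M[R]_(m, n)) (u : 'cV[R]_m) (v : 'cV[R]_n) :
  dotv u (A *m v) = \sum_i \sum_j A i j * (u i 0 * v j 0).
Proof.
rewrite dotv_sum; apply: eq_bigr => i _; rewrite mxE mulr_sumr.
by apply: eq_bigr => j _; rewrite mulrCA.
Qed.

Lemma is_derive_coord n (u : R -> 'cV[R]_n) (t : R) du i :
  is_derive t (1 : R) u du -> is_derive t (1 : R) (fun s => u s i 0) (du i 0).
Proof.
move=> [/[dup] du' /derivable_mxP /(_ i 0) dui <-]; split=> //.
by rewrite derive_mx// mxE.
Qed.

Lemma is_derive_bilinear m n (A : 'M[R]_(m, n)) (u : R -> 'cV[R]_m)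
    (v : R -> 'cV[R]_n) (t : R) du dv :
  is_derive t (1 : R) u du -> is_derive t (1 : R) v dv ->
  is_derive t (1 : R) (fun s => dotv (u s) (A *m v s))
    (dotv du (A *m v t) + dotv (u t) (A *m dv)).
Proof.
move=> dut dvt.
have -> : (fun s => dotv (u s) (A *m v s)) =
    \sum_i \sum_j (A i j *: ((fun s => u s i 0) * (fun s => v s j 0))).
  apply/funext => s; rewrite dotv_mulmx_sum fct_sumE.
  by apply: eq_bigr => i _; rewrite fct_sumE.
rewrite !dotv_mulmx_sum -big_split /=.
apply: is_derive_sum => i; rewrite -big_split /=; apply: is_derive_sum => j.
have du_i := is_derive_coord i dut; have dv_j := is_derive_coord j dvt.
apply: is_derive_eq; rewrite -mulrDr; congr (_ * _).
by rewrite addrC; congr (_ + _); exact: mulrC.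
Qed.

Lemma within_continuous_bilinear m n (A : 'M[R]_(m, n)) (D : set R)
    (u : R -> 'cV[R]_m) (v : R -> 'cV[R]_n) :
  {within D, continuous u} -> {within D, continuous v} ->
  {within D, continuous (fun s => dotv (u s) (A *m v s))}.
Proof.
move=> cu cv.
under eq_fun do rewrite dotv_mulmx_sum.
move=> t.
apply: cvg_big => [|i _]; first exact: add_continuous.
apply: cvg_big => [|j _]; first exact: add_continuous.
apply: cvgM; first exact: cvg_cst.
apply: cvgM.
  apply: (@cvg_comp _ _ _ u (fun M : 'cV[R]_m => M i 0) _ _ _ (cu t)).
  exact: coord_continuous.
apply: (@cvg_comp _ _ _ v (fun M : 'cV[R]_n => M j 0) _ _ _ (cv t)).
exact: coord_continuous.
Qed.

(** Gronwall's inequality in differential form: expR (rho * t) * V t is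
    nonincreasing. *)
Lemma exponential_decay (V dV : R -> R) (rho : R) :
  {within `[0, +oo[, continuous V} ->
  (forall t : R, 0 < t -> is_derive t (1 : R) V (dV t)) ->
  (forall t : R, 0 < t -> dV t <= - rho * V t) ->
  forall t : R, 0 <= t -> V t <= expR (- rho * t) * V 0.
Proof.
move=> cV derV decV t t0.
pose g : R -> R := (fun s : R => expR (rho * s)) * V.
have dg (s : R) : 0 < s ->
    is_derive s (1 : R) g (expR (rho * s) * (dV s + rho * V s)).
  move=> s0; have dVs := derV _ s0.
  have dexp : is_derive s (1 : R) (fun s : R => expR (rho * s))
      (rho * expR (rho * s)).
    have drho : is_derive s (1 : R) (fun s : R => rho * s) rho.
      have H : is_derive s (1 : R) (rho *: (id : R -> R)) (rho *: 1).
        exact: is_deriveZ.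
      by apply: is_derive_eq H _; rewrite [LHS]mulr1.
    rewrite [rho * _]mulrC.
    exact: (@is_derive1_comp _ expR (fun s : R => rho * s)).
  apply: is_derive_eq; rewrite /GRing.scale /=; ring.
have : g t <= g 0.
  apply: (@ler0_derive1_nincry R g 0) => //.
  - by move=> s; rewrite in_itv/= andbT => /dg [].
  - move=> s; rewrite in_itv/= andbT => s0; rewrite derive1E.
    have [_ ->] := dg _ s0; rewrite pmulr_rle0 ?expR_gt0//.
    by have := decV _ s0; lra.
  - have cexp : continuous (fun s : R => expR (rho * s)).
      move=> s; apply: continuous_comp; last exact: continuous_expR.
      exact: mulrl_continuous.
    move=> s; apply: cvgM; last exact: cV.
    exact: (continuous_subspaceT cexp).
have gE s : g s = expR (rho * s) * V s by [].
rewrite !gE mulr0 expR0 mul1r mulNr expRN => gt0.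
by rewrite ler_pdivlMl ?expR_gt0.
Qed.

End Curves.

(** * The Lyapunov function *)

Section Lyapunov.
Context {R : realType} (m n : nat) (T : 'M[R]_(m, n)).

(** The derivative of the energy along the flow vanishes where e = 0, even if
    nu <> 0; the cross term tilts the level sets so that the flow enters them
    there too. *)
Definition lyapunov (eps : R) (e : 'cV[R]_n) (nu : 'cV[R]_m) : R :=
  2^-1 * (dotv e e + dotv nu nu) + eps * dotv nu (T *m e).

(** The cross term is (T^T nu).e, at most (k2 |nu|^2 + |e|^2) / 2 in absolute
    value, which eps scales down to a quarter of |e|^2 + |nu|^2. *)
Lemma lyapunov_equiv (eps k2 : R) e nu : 0 <= eps -> eps <= 2^-1 ->
  eps * k2 <= 2^-1 -> loewner_le (T *m T^T) k2%:M ->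
  4^-1 * (dotv e e + dotv nu nu) <= lyapunov eps e nu
    <= dotv e e + dotv nu nu.
Proof.
move=> eps0 eps1 epsk kT; rewrite /lyapunov dotv_mulmx.
have half0 : (0 : R) < 2^-1 by rewrite invr_gt0.
have up := dotv_young (T^T *m nu) e half0.
have := dotv_young (T^T *m nu) (- e) half0.
rewrite !dotv_linear opprK (_ : 4 * 2^-1 = 2 :> R) in up *; last by field.
have low := gram_le_scalar nu kT.
have ee := dotv_ge0 e; have nn := dotv_ge0 nu.
have Hn : eps * dotv (T^T *m nu) (T^T *m nu) <= 2^-1 * dotv nu nu.
  apply: le_trans (ler_wpM2l eps0 low) _.
  by rewrite mulrA ler_wpM2r.
have He : eps * dotv e e <= 2^-1 * dotv e e by rewrite ler_wpM2r.
move=> /(ler_wpM2l eps0) dn; move: (ler_wpM2l eps0 up) => {}up.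
move: dn up; rewrite mulrN !mulrDr !mulrA.
by move=> *; apply/andP; split; lra.
Qed.

(** With h the increment of the gradient, the left-hand side of the conclusion
    is the derivative of [lyapunov] along the flow.  With p = T^T nu and q = T^T T e it equals
      - h.e - alpha |T e|^2 + eps (|T e|^2 - |p|^2 - p.h - alpha p.q).
    Young's inequality spends half of - eps |p|^2 on the two cross terms; the
    conditions on eps let half of - h.e - alpha |T e|^2 absorb |h|^2, |q|^2 and
    |T e|^2.  The other half gives - rho |e|^2 by coercivity, and the rest of
    - eps |p|^2 gives - rho |nu|^2. *)
Lemma lyapunov_dissipation (eps alpha L mu k1 k2 rho : R) e nu h de :
  de = - h - T^T *m nu - alpha *: (T^T *m (T *m e)) ->
  0 < eps -> 0 < mu -> 0 < k1 -> 0 <= rho ->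
  eps * L <= 2^-1 -> eps * (1 + alpha ^+ 2 * k2) <= alpha / 2 ->
  rho <= mu / 2 -> rho <= alpha * k1 / 2 -> rho <= eps * k1 / 2 ->
  loewner_le k1%:M (T *m T^T) -> loewner_le (T *m T^T) k2%:M ->
  0 <= dotv h e -> dotv h h <= L * dotv h e ->
  dotv e e <= dotv h e / mu + dotv (T *m e) (T *m e) / k1 ->
  dotv e de + dotv nu (T *m e)
    + eps * (dotv (T *m e) (T *m e) + dotv nu (T *m de))
    <= - rho * (dotv e e + dotv nu nu).
Proof.
move=> -> eps0 mu0 k10 rho0 epsL epsa rho1 rho2 rho3 kT1 kT2 he0 hh ee.
have eps_ge0 := ltW eps0.
rewrite (dotv_mulmx T nu (_ - _)).
rewrite !dotv_linear (dotv_mulmx T^T e) trmxK (dotv_mulmx T^T e) trmxK.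
rewrite (dotvC e h) (dotvC (T *m e) nu).
set p := T^T *m nu; set q := T^T *m (T *m e).
have quarter0 : (0 : R) < 4^-1 by rewrite invr_gt0.
have four4 : 4 * 4^-1 = 1 :> R by field.
have young1 := dotv_young p (- h) quarter0.
have young2 := dotv_young p (- (alpha *: q)) quarter0.
rewrite !dotv_linear !opprK four4 !divr1 in young1 young2.
have pp := scalar_le_gram nu kT1; have qq := gram_le_scalar (T *m e) kT2.
rewrite -/p -/q in pp qq.
have nn := dotv_ge0 nu; have tt := dotv_ge0 (T *m e).
move: (dotv nu nu) (dotv (T *m e) (T *m e)) (dotv h e) (dotv e e) (dotv h h)
  (dotv p p) (dotv q q) (dotv p h) (dotv p q) (dotv nu (T *m e))
  he0 hh ee young1 young2 pp qq nn tt.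
move=> nn tt he ee hh pp qq ph pq nt he0 hhL eeB young1 young2 ppB qqB nn0 tt0.
have Hh : eps * hh <= 2^-1 * he.
  by apply: le_trans (ler_wpM2l eps_ge0 hhL) _; rewrite mulrA ler_wpM2r.
have Ht : eps * (tt + alpha ^+ 2 * qq) <= alpha / 2 * tt.
  apply: le_trans (ler_wpM2r tt0 epsa); rewrite -[X in _ <= X]mulrA ler_wpM2l//.
  by rewrite mulrDl mul1r lerD2l -[X in _ <= X]mulrA ler_wpM2l// sqr_ge0.
have Hn : 2 * rho * nn <= eps * pp.
  apply: le_trans (ler_wpM2l eps_ge0 ppB).
  by rewrite mulrA ler_wpM2r//; lra.
have He : rho * ee <= 2^-1 * he + alpha / 2 * tt.
  apply: le_trans (ler_wpM2l rho0 eeB) _; rewrite mulrDr lerD//.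
    rewrite mulrCA mulrC ler_wpM2r// ler_pdivrMr//; lra.
  by rewrite mulrCA mulrC ler_wpM2r// ler_pdivrMr//; lra.
have Hp : eps * (- ph - alpha * pq) <= eps * (2^-1 * pp + hh + alpha ^+ 2 * qq).
  by rewrite ler_wpM2l//; lra.
lra.
Qed.

End Lyapunov.

Lemma is_derive_lyapunov (R : realType) m n (T : 'M[R]_(m, n)) eps
    (u : R -> 'cV[R]_n) (v : R -> 'cV[R]_m) (t : R) du dv :
  is_derive t (1 : R) u du -> is_derive t (1 : R) v dv ->
  is_derive t (1 : R) (fun s => lyapunov T eps (u s) (v s))
    (dotv (u t) du + dotv (v t) dv
     + eps * (dotv dv (T *m u t) + dotv (v t) (T *m du))).
Proof.
move=> dut dvt.
have duu := is_derive_bilinear 1%:M dut dut.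
have dvv := is_derive_bilinear 1%:M dvt dvt.
have dvu := is_derive_bilinear T dvt dut.
have dV := is_deriveD (is_deriveZ 2^-1 (is_deriveD duu dvv))
  (is_deriveZ eps dvu).
rewrite (_ : (fun s => lyapunov T eps (u s) (v s)) =
    2^-1 *: ((fun s => dotv (u s) (1%:M *m u s))
             + (fun s => dotv (v s) (1%:M *m v s)))
    + eps *: (fun s => dotv (v s) (T *m u s))); last first.
  by apply/funext => s; rewrite !fctE !mul1mx.
apply: is_derive_eq dV _.
rewrite !mul1mx (dotvC du) (dotvC dv (v t)).
by rewrite /GRing.scale /=; field.
Qed.

Lemma within_continuous_lyapunov (R : realType) m n (T : 'M[R]_(m, n)) eps
    (D : set R) (u : R -> 'cV[R]_n) (v : R -> 'cV[R]_m) :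
  {within D, continuous u} -> {within D, continuous v} ->
  {within D, continuous (fun s => lyapunov T eps (u s) (v s))}.
Proof.
move=> cu cv.
have cuu := within_continuous_bilinear (A := 1%:M) cu cu.
have cvv := within_continuous_bilinear (A := 1%:M) cv cv.
have cvu := within_continuous_bilinear (A := T) cv cu.
under eq_fun do rewrite /lyapunov -[X in dotv _ X + _]mul1mx
  -[X in _ + dotv _ X]mul1mx.
move=> t; apply: cvgD; apply: cvgM.
- exact: cvg_cst.
- by apply: cvgD; [exact: cuu|exact: cvv].
- exact: cvg_cst.
- exact: cvu.
Qed.

(** Used to pick eps and rho below finitely many positive thresholds. *)
Lemma exists_pos_lower_bound (R : realDomainType) (s : seq R) :
  all (>%R^~ 0) s -> exists2 eps, 0 < eps & all (<=%R eps) s.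
Proof.
elim: s => [_|a s IH /= /andP[a0 /IH[eps eps0 epss]]]; first by exists 1.
exists (Num.min a eps); first by rewrite lt_min a0.
rewrite ge_min lexx /=; apply: sub_all epss => b.
by rewrite ge_min orbC => ->.
Qed.

(** * Convergence of the primal-dual flow *)

Theorem theorem1 (R : realType) (m n : nat) (hm : (0 < m)%N)
    (hmn : (m <= n)%N) (f : 'cV[R]_n -> R) (T : 'M[R]_(m, n)) (b : 'cV[R]_m)
    (alpha : R) (halpha : 0 < alpha)
    (hdiff : forall x : 'cV[R]_n, differentiable f x)
    (hconvex : forall x xh : 'cV[R]_n,
       0 <= dotv (grad f x - grad f xh) (x - xh))
    (hsmooth : exists l : R, 0 < l /\ forall x xh : 'cV[R]_n,
       dotv (grad f x - grad f xh) (x - xh) <= l * enorm (x - xh) ^+ 2)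
    (hrank : row_free T)
    (hkappa : exists kappa1 kappa2 : R,
       [/\ 0 < kappa1, kappa1 <= kappa2,
           loewner_le (kappa1%:M) (T *m T^T)
         & loewner_le (T *m T^T) (kappa2%:M)])
    (hpsc : (m < n)%N -> exists (Q : 'M[R]_n) (Rf : 'M[R]_(n, m)),
       is_QR hmn T^T Q Rf /\
       exists mu : R, 0 < mu /\
         partially_strongly_convex mu [set i : 'I_n | (m <= i)%N]%SET
           (fun x' : 'cV[R]_n => f (Q *m x')))
    (hopt : exists xs : 'cV[R]_n, is_optimal f T b xs) :
  forall xs : 'cV[R]_n, is_optimal f T b xs ->
    exponentially_converges f T b alpha xs.
Proof.
move=> xs xs_opt; have [l [l0 smf]] := hsmooth.
have [k1 [k2 [k10 k12 kT1 kT2]]] := hkappa; have k20 := lt_le_trans k10 k12.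
have [ls lsE] := multiplier_exists hdiff (gram_unitmx k10 kT1) xs_opt.
have Txs : T *m xs = b by case: xs_opt.
have [mu mu0 coercive] :=
  partial_to_constraint_coercivity hdiff hconvex k10 kT1 hpsc.
have L0 : 0 < 2 * l by rewrite mulr_gt0.
have d0 : 0 < 1 + alpha ^+ 2 * k2 by rewrite addr_gt0// mulr_gt0// exprn_gt0.
have [eps eps0 /and5P[eps1 epsk epsL epsa _]] :
    exists2 eps, 0 < eps & all (<=%R eps)
      [:: 2^-1; 2^-1 / k2; 2^-1 / (2 * l); alpha / 2 / (1 + alpha ^+ 2 * k2)].
  have a20 : 0 < alpha / 2 by rewrite divr_gt0.
  by apply: exists_pos_lower_bound; rewrite /= !(divr_gt0, invr_gt0, ltr0n).
have [rho rho0 /and4P[rho1 rho2 rho3 _]] :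
    exists2 rho, 0 < rho & all (<=%R rho)
      [:: mu / 2; alpha * k1 / 2; eps * k1 / 2].
  by apply: exists_pos_lower_bound; rewrite /= !(divr_gt0, mulr_gt0).
rewrite ler_pdivlMr// in epsk; rewrite ler_pdivlMr// in epsL.
rewrite ler_pdivlMr// in epsa.
exists ls; split.
  split; last by rewrite /apdg_lam Txs subrr.
  by rewrite /apdg_x Txs subrr mulmx0 scaler0 subr0 -opprD lsE oppr0.
(* |e|^2 <= 4 V and V (0) <= |e (0)|^2 + |nu (0)|^2: taking square roots turns
   the factor 4 into 2 and halves the rate. *)
exists 2, (rho / 2); split; [by []|by rewrite divr_gt0|].
move=> x lam [cx clam traj] t t0.
pose e s := x s - xs; pose nu s := lam s - ls.
pose V s := lyapunov T eps (e s) (nu s).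
have equiv s := lyapunov_equiv (e s) (nu s) (ltW eps0) eps1 epsk kT2.
have velocityE s : apdg_x f T b alpha (x s) (lam s) =
    - (grad f (x s) - grad f xs) - T^T *m nu s - alpha *: (T^T *m (T *m e s)).
  rewrite /apdg_x /nu /e !mulmxBr Txs; congr (_ - _).
  have -> : grad f xs = - (T^T *m ls) by apply/eqP; rewrite -addr_eq0 lsE.
  by rewrite opprK opprD opprB addrA subrK.
have decay : V t <= expR (- rho * t) * V 0.
  apply: (@exponential_decay _ V (fun s =>
    dotv (e s) (apdg_x f T b alpha (x s) (lam s))
    + dotv (nu s) (apdg_lam T b (x s))
    + eps * (dotv (apdg_lam T b (x s)) (T *m e s)
             + dotv (nu s) (T *m apdg_x f T b alpha (x s) (lam s))))) => //.
  - apply: within_continuous_lyapunov => s; apply: cvgB;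
      by [exact: cx|exact: clam|exact: cvg_cst].
  - move=> s s0; have [dx dlam] := traj s s0.
    apply: is_derive_lyapunov.
      apply: is_derive_eq (is_deriveB dx (is_derive_cst xs _ _)) _.
      by rewrite subr0.
    apply: is_derive_eq (is_deriveB dlam (is_derive_cst ls _ _)) _.
    by rewrite subr0.
  - move=> s s0; have -> : apdg_lam T b (x s) = T *m e s by rewrite mulmxBr Txs.
    apply: (@le_trans _ _ (- rho * (dotv (e s) (e s) + dotv (nu s) (nu s)))).
      apply: (lyapunov_dissipation (velocityE s) eps0 mu0 k10 (ltW rho0)
        epsL epsa rho1 rho2 rho3 kT1 kT2).
      + exact: hconvex.
      + exact: gradient_cocoercive.
      + exact: coercive.
    by rewrite !mulNr lerN2 ler_pM2l//; case/andP: (equiv s).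
have E0 := dotv_ge0 (col_mx (e 0) (nu 0)).
rewrite -(@ler_pXn2r _ 2) ?nnegrE ?sqrtr_ge0//; last first.
  by rewrite !mulr_ge0 ?expR_ge0 ?sqrtr_ge0.
rewrite !exprMn !enorm_sqr dotv_col_mx -expRM_natr.
rewrite (_ : - (rho / 2) * t * 2%:R = - rho * t); last by field.
have /andP[Vlow _] := equiv t; have /andP[_ Vup] := equiv 0.
have := le_trans decay (ler_wpM2l (expR_ge0 (- rho * t)) Vup).
have := dotv_ge0 (nu t).
rewrite -/(e t) -/(e 0) -/(nu 0) -/(V t) in Vlow *.
by rewrite -mulrA; lra.
Qed.
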